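(* Let $0<\phi<\pi/2$. (i) Let $u_1>0$ and let $p:[0,u_1]\to\mathbb{R}$ be a twice continuously differentiable function such that $p(u)+p''(u)>0$ for all $u\in[0,u_1]$, $p(0)=p(u_1)=0$, and $p(u)>0$ for $0<u<u_1$. Let $n$ be the integer determined by $$(n+1)\phi < u_1 \leq (n+2)\phi.$$ Then the numbers $$a_k = p((k+1)\phi),\quad k=-1,0,1,\ldots,n,\qquad a_{n+1}=0$$ solve the system of inequalities $$a_{k-1}+a_{k+1}-2a_k\cos\phi>0,\quad a_k>0\quad (k=0,1,\ldots,n),\qquad a_{-1}=a_{n+1}=0.$$ (ii) Conversely, for every integer $n\ge 0$, every solution $(a_{-1},a_0,\ldots,a_n,a_{n+1})$ of this system arises in the manner described in (i) from some $u_1>0$ with $(n+1)\phi<u_1\le (n+2)\phi$ and some function $p$ with the listed properties. *)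

(* Defs.v *)
From Stdlib Require Import Reals ZArith.
Open Scope R_scope.

Definition Icc (a b x : R) : Prop := a <= x <= b.

(* A function on [0, u1] is a total function R -> R of which only the values
   on [0, u1] matter: [D_in] and [continue_in] take limits within the given
   domain, so they are one-sided at 0 and at u1. *)
Definition admissible (u1 : R) (p : R -> R) : Prop :=
  (exists p' p'' : R -> R,
      (forall u, Icc 0 u1 u -> D_in p p' (Icc 0 u1) u) /\
      (forall u, Icc 0 u1 u -> D_in p' p'' (Icc 0 u1) u) /\
      (forall u, Icc 0 u1 u -> continue_in p'' (Icc 0 u1) u) /\
      (forall u, Icc 0 u1 u -> p u + p'' u > 0)) /\
  p 0 = 0 /\ p u1 = 0 /\
  (forall u, 0 < u < u1 -> p u > 0).

(* Finite sequences (a_{-1}, ..., a_{n+1}) are functions Z -> R of which only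
   the values at indices -1, ..., n+1 matter. *)
Definition sampled_from (phi : R) (n : Z) (p : R -> R) (a : Z -> R) : Prop :=
  (forall k : Z, (-1 <= k <= n)%Z -> a k = p ((IZR k + 1) * phi)) /\
  a (n + 1)%Z = 0.

Definition solves_system (phi : R) (n : Z) (a : Z -> R) : Prop :=
  (forall k : Z, (0 <= k <= n)%Z ->
     a (k - 1)%Z + a (k + 1)%Z - 2 * a k * cos phi > 0 /\ a k > 0) /\
  a (-1)%Z = 0 /\ a (n + 1)%Z = 0.

(* Main.v *)
Require Import Defs.
From Stdlib Require Import Reals ZArith.
From Stdlib Require Import Lra Lia.
From Coquelicot Require Import Coquelicot.
Open Scope R_scope.

(** For fixed [z], the function [p' u * sin (z - u) + p u * cos (z - u)] has
    derivative [(p u + p'' u) * sin (z - u)] and equals [p z] at [u = z]; hence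
    [p] lies strictly above each of its tangent sinusoids at distance less than
    [PI].  Comparing two neighbours of a point with the tangent sinusoid there
    gives (i).

    For (ii) take [u1 = (n + 2) * phi] and build [p] one interval of length [phi]
    at a time, as a sinusoid plus [(A + B * t) * exp (- N * t)].  Each arc has
    prescribed value, slope and second derivative at its left end and prescribed
    value at its right end.  For large [N] its slope at the right end is so close
    to that of the sinusoid through the two end values that the inequality of the
    system at that node leaves room for the next arc to start.  Positivity of an
    arc follows from its tangent sinusoid at the right end (at the left end for
    the first arc). *)

(** * One-sided derivatives and the mean value theorem on a closed interval *)

Lemma D_in_eq (f d d' : R -> R) (D : R -> Prop) (x : R) :
  d x = d' x -> D_in f d D x -> D_in f d' D x.
Proof. intros e H. unfold D_in in *. now rewrite <- e. Qed.

Lemma is_derive_D_in (f d : R -> R) (D : R -> Prop) (x : R) :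
  is_derive f x (d x) -> D_in f d D x.
Proof.
  intros H. apply is_derive_Reals in H.
  apply derivable_pt_lim_D_in in H.
  unfold D_in in *. apply limit1_imp with (2 := H).
  intros y [_ Hy]. now split.
Qed.

Lemma continuity_pt_continue_in (f : R -> R) (D : R -> Prop) (x : R) :
  continuity_pt f x -> continue_in f D x.
Proof.
  intros H eps heps. destruct (H eps heps) as [alp [ha Ha]].
  exists alp. split; [exact ha|].
  intros y [[_ hne] hd]. apply Ha. repeat split; auto.
Qed.

(** Precomposing [f] with the clamp [cl] onto [[x, y]] turns one-sided limits into two-sided ones:
    [cl] is 1-Lipschitz and fixes [[x, y]], so [g] is continuous at the end points too and has
    derivative [df] inside. *)
Lemma MVT_D_in (f df : R -> R) (x y : R) :
  x < y ->
  (forall u, Icc x y u -> D_in f df (Icc x y) u) ->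
  exists c, x < c < y /\ f y - f x = df c * (y - x).
Proof.
  intros hxy Hd.
  set (cl := fun u => Rmax x (Rmin y u)).
  assert (clI : forall u, Icc x y u -> cl u = u).
  { intros u [h1 h2]. unfold cl. rewrite Rmin_right by lra. now rewrite Rmax_right. }
  assert (clin : forall u, Icc x y (cl u)).
  { intros u. unfold cl, Icc, Rmax, Rmin.
    destruct (Rle_dec y u); destruct Rle_dec; lra. }
  assert (cllip : forall u v, Rabs (cl u - cl v) <= Rabs (u - v)).
  { intros u v. unfold cl, Rmax, Rmin.
    destruct (Rle_dec y u), (Rle_dec y v); repeat destruct Rle_dec;
      unfold Rabs; repeat destruct Rcase_abs; lra. }
  set (g := fun u => f (cl u)).
  assert (gc : forall c, x <= c <= y -> continuity_pt g c).
  { intros c hc eps heps.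
    destruct (cont_deriv _ _ _ _ (Hd c hc) eps heps) as [alp [ha Ha]].
    exists alp. split; [exact ha|].
    intros u [_ hu]. unfold g. rewrite (clI c hc).
    destruct (Req_dec c (cl u)) as [e|ne].
    - rewrite <- e. simpl. unfold Rdist. rewrite Rminus_diag_eq, Rabs_R0; auto.
    - apply Ha. repeat split; auto; try apply clin.
      simpl in *. unfold Rdist in *. rewrite <- (clI c hc) at 1.
      eapply Rle_lt_trans; [apply cllip | exact hu]. }
  assert (gd : forall c, x < c < y -> derivable_pt_lim g c (df c)).
  { intros c hc eps heps.
    assert (hcI : Icc x y c) by (unfold Icc; lra).
    destruct (Hd c hcI eps heps) as [alp [ha Ha]].
    assert (hm : 0 < Rmin alp (Rmin (c - x) (y - c))).
    { repeat apply Rmin_glb_lt; lra. }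
    exists (mkposreal _ hm). intros h hne hh. simpl in hh.
    assert (h1 := Rlt_le_trans _ _ _ hh (Rmin_l _ _)).
    assert (h2 := Rlt_le_trans _ _ _ hh (Rmin_r _ _)).
    assert (h3 := Rlt_le_trans _ _ _ h2 (Rmin_l _ _)).
    assert (h4 := Rlt_le_trans _ _ _ h2 (Rmin_r _ _)).
    apply Rabs_def2 in h3. apply Rabs_def2 in h4.
    assert (hchI : Icc x y (c + h)) by (unfold Icc; lra).
    unfold g. rewrite (clI c hcI), (clI (c + h) hchI).
    specialize (Ha (c + h)). simpl in Ha. unfold Rdist in Ha.
    replace (c + h - c) with h in Ha by ring.
    apply Ha. repeat split; auto; try apply hchI. lra. }
  destruct (MVT g id x y (fun c hc => exist _ (df c) (gd c hc))
              (fun c _ => derivable_pt_id c) hxy gc) as [c [P e]].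
  { intros c _. apply derivable_continuous_pt, derivable_pt_id. }
  exists c. split; [exact P|].
  rewrite derive_pt_id in e. simpl in e. unfold id, g in e.
  rewrite !clI in e by (unfold Icc; lra). lra.
Qed.

(** * Comparison with tangent sinusoids *)

Section Tangent.

Variables (l r : R) (p p' p'' : R -> R).
Hypothesis Hp : forall u, Icc l r u -> D_in p p' (Icc l r) u.
Hypothesis Hp' : forall u, Icc l r u -> D_in p' p'' (Icc l r) u.
Hypothesis Hpos : forall u, Icc l r u -> p u + p'' u > 0.

(** The point [z] is left free: on an interval shorter than [PI], [sin (z - c)] has a known sign
    once [z] is an end point. The right end yields [tangent_right], the left end [tangent_left]. *)
Lemma sturm_increment (z x y : R) :
  l <= x -> x < y -> y <= r ->
  exists c, x < c < y /\ p c + p'' c > 0 /\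
    (p' y * sin (z - y) + p y * cos (z - y))
    - (p' x * sin (z - x) + p x * cos (z - x))
    = (p c + p'' c) * sin (z - c) * (y - x).
Proof.
  intros h1 h2 h3.
  destruct (MVT_D_in (fun u => p' u * sin (z - u) + p u * cos (z - u))
              (fun u => (p u + p'' u) * sin (z - u)) x y h2) as [c [hc e]].
  - intros u [hu1 hu2].
    assert (huI : Icc l r u) by (unfold Icc; lra).
    assert (sub : forall f d, D_in f d (Icc l r) u -> D_in f d (Icc x y) u).
    { intros f d H. unfold D_in in *. apply limit1_imp with (2 := H).
      unfold D_x, Icc. intros w [hw hne]. split; [lra | exact hne]. }
    eapply D_in_eq; cycle 1.
    + apply Dadd.
      * apply Dmult; [apply sub, Hp', huI|].
        apply (is_derive_D_in _ (fun u => - cos (z - u))).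
        auto_derive; [trivial | unfold Rminus; ring].
      * apply Dmult; [apply sub, Hp, huI|].
        apply (is_derive_D_in _ (fun u => sin (z - u))).
        auto_derive; [trivial | unfold Rminus; ring].
    + simpl. ring.
  - exists c. split; [exact hc|]. split; [|exact e].
    apply Hpos. unfold Icc. lra.
Qed.

Lemma tangent_right (y z : R) :
  l <= y -> y < z -> z <= r -> z - y < PI ->
  p y * cos (z - y) + p' y * sin (z - y) < p z.
Proof.
  intros h1 h2 h3 h4.
  destruct (sturm_increment z y z h1 h2 h3) as [c [hc [hf e]]].
  assert (hs : 0 < sin (z - c)) by (apply sin_gt_0; lra).
  assert (h0 : 0 < (p c + p'' c) * sin (z - c) * (z - y)).
  { apply Rmult_lt_0_compat; [apply Rmult_lt_0_compat|]; lra. }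
  replace (z - z) with 0 in e by ring. rewrite sin_0, cos_0 in e. lra.
Qed.

Lemma tangent_left (x y : R) :
  l <= x -> x < y -> y <= r -> y - x < PI ->
  p y * cos (y - x) - p' y * sin (y - x) < p x.
Proof.
  intros h1 h2 h3 h4.
  destruct (sturm_increment x x y h1 h2 h3) as [c [hc [hf e]]].
  assert (hs : 0 < sin (c - x)) by (apply sin_gt_0; lra).
  assert (h0 : 0 < (p c + p'' c) * sin (c - x) * (y - x)).
  { apply Rmult_lt_0_compat; [apply Rmult_lt_0_compat|]; lra. }
  replace (x - x) with 0 in e by ring. rewrite sin_0, cos_0 in e.
  replace (x - c) with (- (c - x)) in e by ring.
  replace (x - y) with (- (y - x)) in e by ring.
  rewrite !sin_neg, cos_neg in e. lra.
Qed.

(** Weighting the two tangent inequalities at [y] by [sin (y - x)] and [sin (z - y)] cancels [p' y].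
    The gaps may differ because the last sample can be closer than [phi] to [u1]. *)
Lemma three_point (x y z : R) :
  l <= x -> x < y -> y < z -> z <= r -> y - x < PI -> z - y < PI ->
  p y * sin (z - x) < p x * sin (z - y) + p z * sin (y - x).
Proof.
  intros h1 h2 h3 h4 h5 h6.
  assert (T1 := tangent_right y z ltac:(lra) h3 h4 h6).
  assert (T2 := tangent_left x y h1 h2 ltac:(lra) h5).
  assert (s1 : 0 < sin (z - y)) by (apply sin_gt_0; lra).
  assert (s2 : 0 < sin (y - x)) by (apply sin_gt_0; lra).
  replace (z - x) with ((z - y) + (y - x)) by ring. rewrite sin_plus.
  apply (Rmult_lt_compat_r _ _ _ s2) in T1.
  apply (Rmult_lt_compat_r _ _ _ s1) in T2. lra.
Qed.

End Tangent.

(** * Part (i): samples satisfy the system *)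

Lemma sampled_solves (phi u1 : R) (p : R -> R) (n : Z) (a : Z -> R) :
  0 < phi < PI / 2 -> 0 < u1 -> admissible u1 p ->
  (IZR n + 1) * phi < u1 <= (IZR n + 2) * phi ->
  sampled_from phi n p a -> solves_system phi n a.
Proof.
  intros hphi hu [[p' [p'' [Hp [Hp' [_ Hpos]]]]] [p0 [p1 ppos]]] [hu1 hu2] [Hs Ha].
  assert (T3 := three_point 0 u1 p p' p'' Hp Hp' Hpos).
  assert (hS : 0 < sin phi) by (apply sin_gt_0; lra).
  (* Otherwise [u1 <= (n + 2) * phi <= 0]. This puts the index -1 in the range covered by
     [sampled_from]. *)
  assert (hn : (-1 <= n)%Z).
  { destruct (Z_le_gt_dec (-1) n) as [h|h]; [exact h|exfalso].
    assert (h' : (n <= -2)%Z) by lia. apply IZR_le in h'. nra. }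
  split; [|split].
  - intros k [hk0 hkn].
    assert (r0 := IZR_le _ _ hk0). assert (rn := IZR_le _ _ hkn).
    assert (hk1 : 0 < (IZR k + 1) * phi) by (apply Rmult_lt_0_compat; lra).
    assert (hky : (IZR k + 1) * phi <= (IZR n + 1) * phi)
      by (apply Rmult_le_compat_r; lra).
    rewrite (Hs k), (Hs (k - 1)%Z), minus_IZR by lia.
    replace (IZR k - 1 + 1) with (IZR k) by ring.
    assert (hx : 0 <= IZR k * phi) by (apply Rmult_le_pos; lra).
    split; [|apply ppos; lra].
    (* For [k = n] the right neighbour is the zero [u1] of [p], at distance [del <= phi]. The claim,
       multiplied by [sin del], follows from [sin (phi + del) - 2 * cos phi * sin del = sin (phi -
       del) >= 0]. *)
    destruct (Z.eq_dec k n) as [->|hne].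
    + rewrite Ha.
      specialize (T3 (IZR n * phi) ((IZR n + 1) * phi) u1 hx
                    ltac:(lra) hu1 ltac:(lra) ltac:(lra) ltac:(lra)).
      set (del := u1 - (IZR n + 1) * phi) in *.
      assert (hdel : 0 < del <= phi) by (unfold del; lra).
      replace (u1 - IZR n * phi) with (phi + del) in T3 by (unfold del; ring).
      replace ((IZR n + 1) * phi - IZR n * phi) with phi in T3 by ring.
      rewrite p1, sin_plus in T3.
      assert (hsd : 0 < sin del) by (apply sin_gt_0; lra).
      assert (hd : 0 <= sin (phi - del)) by (apply sin_ge_0; lra).
      rewrite sin_minus in hd.
      assert (hpy : 0 < p ((IZR n + 1) * phi)) by (apply ppos; lra).
      assert (h := Rmult_le_pos _ _ (Rlt_le _ _ hpy) hd).
      apply Rmult_gt_reg_l with (sin del); [exact hsd|]. lra.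
    + assert (hk2 : (k + 1 <= n)%Z) by lia.
      assert (r2 := IZR_le _ _ hk2). rewrite plus_IZR in r2.
      assert (hz : (IZR k + 1 + 1) * phi <= (IZR n + 1) * phi)
        by (apply Rmult_le_compat_r; lra).
      rewrite (Hs (k + 1)%Z), plus_IZR by lia.
      specialize (T3 (IZR k * phi) ((IZR k + 1) * phi) ((IZR k + 1 + 1) * phi)
                    hx ltac:(lra) ltac:(lra) ltac:(lra) ltac:(lra) ltac:(lra)).
      replace ((IZR k + 1 + 1) * phi - IZR k * phi) with (2 * phi) in T3 by ring.
      replace ((IZR k + 1) * phi - IZR k * phi) with phi in T3 by ring.
      replace ((IZR k + 1 + 1) * phi - (IZR k + 1) * phi) with phi in T3 by ring.
      rewrite sin_2a in T3.
      apply Rmult_gt_reg_l with (sin phi); [exact hS|]. lra.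
  - rewrite (Hs (-1)%Z) by lia. now replace ((-1 + 1) * phi) with 0 by ring.
  - exact Ha.
Qed.

(** * Twice continuously differentiable functions: gluing and single arcs *)

(** Derivatives are two-sided on the whole line, so that arcs can be shifted and glued without
    tracking domains; the restriction to [[0, u1]] comes last. *)
Definition C2_with (p p' p'' : R -> R) : Prop :=
  (forall u, is_derive p u (p' u)) /\
  (forall u, is_derive p' u (p'' u)) /\
  (forall u, continuity_pt p'' u).

Definition glue (L : R) (f g : R -> R) (u : R) : R :=
  if Rle_dec u L then f u else g u.

Lemma glue_le (L : R) (f g : R -> R) (u : R) : u <= L -> glue L f g u = f u.
Proof. intros h. unfold glue. now destruct Rle_dec. Qed.

Lemma glue_ge (L : R) (f g : R -> R) (u : R) :
  f L = g L -> L <= u -> glue L f g u = g u.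
Proof.
  intros e h. unfold glue. destruct Rle_dec; [|easy].
  now replace u with L by lra.
Qed.

Lemma continuity_pt_glue (L : R) (f g : R -> R) :
  f L = g L -> (forall u, continuity_pt f u) -> (forall u, continuity_pt g u) ->
  forall u, continuity_pt (glue L f g) u.
Proof.
  intros e Hf Hg u eps heps.
  destruct (Hf u eps heps) as [d1 [hd1 H1]].
  destruct (Hg u eps heps) as [d2 [hd2 H2]].
  destruct (Rtotal_order u L) as [h|[h|h]].
  - exists (Rmin d1 (L - u)). split; [apply Rmin_glb_lt; lra|].
    intros x [hx hux]. simpl in *. unfold Rdist in *.
    assert (h3 := Rlt_le_trans _ _ _ hux (Rmin_l _ _)).
    assert (h4 := Rlt_le_trans _ _ _ hux (Rmin_r _ _)).
    apply Rabs_def2 in h4. rewrite !glue_le by lra. apply H1. now split.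
  - exists (Rmin d1 d2). split; [apply Rmin_glb_lt; lra|].
    intros x [hx hux]. simpl in *. unfold Rdist in *.
    assert (h3 := Rlt_le_trans _ _ _ hux (Rmin_l _ _)).
    assert (h4 := Rlt_le_trans _ _ _ hux (Rmin_r _ _)).
    destruct (Rle_dec x L).
    + rewrite !glue_le by lra. apply H1. now split.
    + rewrite !glue_ge by (auto; lra). apply H2. now split.
  - exists (Rmin d2 (u - L)). split; [apply Rmin_glb_lt; lra|].
    intros x [hx hux]. simpl in *. unfold Rdist in *.
    assert (h3 := Rlt_le_trans _ _ _ hux (Rmin_l _ _)).
    assert (h4 := Rlt_le_trans _ _ _ hux (Rmin_r _ _)).
    apply Rabs_def2 in h4. rewrite !glue_ge by (auto; lra). apply H2. now split.
Qed.

Lemma is_derive_glue (L : R) (f f' g g' : R -> R) :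
  f L = g L -> f' L = g' L ->
  (forall u, is_derive f u (f' u)) -> (forall u, is_derive g u (g' u)) ->
  forall u, is_derive (glue L f g) u (glue L f' g' u).
Proof.
  intros e e' Hf Hg u. apply is_derive_Reals. intros eps heps.
  assert (Hfu := Hf u). assert (Hgu := Hg u).
  apply is_derive_Reals in Hfu. apply is_derive_Reals in Hgu.
  destruct (Hfu eps heps) as [[d1 hd1] H1].
  destruct (Hgu eps heps) as [[d2 hd2] H2]. simpl in *.
  destruct (Rtotal_order u L) as [h|[h|h]].
  - assert (hm : 0 < Rmin d1 (L - u)) by (apply Rmin_glb_lt; lra).
    exists (mkposreal _ hm). intros k hk hux. simpl in hux.
    assert (h3 := Rlt_le_trans _ _ _ hux (Rmin_l _ _)).
    assert (h4 := Rlt_le_trans _ _ _ hux (Rmin_r _ _)).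
    apply Rabs_def2 in h4. rewrite !glue_le by lra. now apply H1.
  - assert (hm : 0 < Rmin d1 d2) by (apply Rmin_glb_lt; lra).
    exists (mkposreal _ hm). intros k hk hux. simpl in hux.
    assert (h3 := Rlt_le_trans _ _ _ hux (Rmin_l _ _)).
    assert (h4 := Rlt_le_trans _ _ _ hux (Rmin_r _ _)).
    destruct (Rle_dec (u + k) L).
    + rewrite !glue_le by lra. now apply H1.
    + rewrite !glue_ge by (auto; lra). now apply H2.
  - assert (hm : 0 < Rmin d2 (u - L)) by (apply Rmin_glb_lt; lra).
    exists (mkposreal _ hm). intros k hk hux. simpl in hux.
    assert (h3 := Rlt_le_trans _ _ _ hux (Rmin_l _ _)).
    assert (h4 := Rlt_le_trans _ _ _ hux (Rmin_r _ _)).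
    apply Rabs_def2 in h4. rewrite !glue_ge by (auto; lra). now apply H2.
Qed.

Lemma C2_glue (L : R) (p p' p'' q q' q'' : R -> R) :
  C2_with p p' p'' -> C2_with q q' q'' ->
  p L = q L -> p' L = q' L -> p'' L = q'' L ->
  C2_with (glue L p q) (glue L p' q') (glue L p'' q'').
Proof.
  intros [P1 [P2 P3]] [Q1 [Q2 Q3]] e e' e''. split; [|split].
  - now apply is_derive_glue.
  - now apply is_derive_glue.
  - now apply continuity_pt_glue.
Qed.

(* With [N] large, the exponential concentrates [q + q''] near [t = 0], so that
   beyond [t = 0] the function is almost a sinusoid. *)
Lemma arc_exists (phi b s c v eps : R) :
  0 < phi < PI / 2 -> 0 < c -> 0 < eps ->
  b * cos phi + s * sin phi < v ->
  exists q q' q'' : R -> R, C2_with q q' q'' /\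
    q 0 = b /\ q' 0 = s /\ q 0 + q'' 0 = c /\ q phi = v /\
    (forall t, 0 <= t -> 0 < q t + q'' t) /\
    b - v * cos phi + q' phi * sin phi < eps.
Proof.
  intros hphi hc heps hv.
  set (S := sin phi). set (C := cos phi). fold S C in hv.
  assert (hS : 0 < S) by (apply sin_gt_0; lra).
  assert (hC : 0 < C) by (apply cos_gt_0; lra).
  assert (hS1 : S <= 1) by apply SIN_bound.
  assert (hC1 : C <= 1) by apply COS_bound.
  assert (hSC : S * S + C * C = 1) by apply sin2_cos2.
  (* The amount by which the target [v] exceeds the value at [phi] of the tangent sinusoid at 0. *)
  set (al := v - b * C - s * S). assert (hal : 0 < al) by (unfold al; lra).
  (* The first two bounds serve [S / 2 <= K] and [0 <= T], the third makes [B] positive, and the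
     last two give [A < eps / 2] and [B * E < eps / 2]. *)
  assert (hex : exists N, 2 <= N /\ 8 <= N * S /\ 2 * c < N * al /\
    2 * (c + 4 * al / S) < N * eps /\ 4 * al / S / phi < N * eps).
  { assert (hSp : 0 < 4 * al / S) by (apply Rdiv_lt_0_compat; lra).
    assert (hSpp : 0 < 4 * al / S / phi) by (apply Rdiv_lt_0_compat; lra).
    assert (i1 : 0 < 8 / S) by (apply Rdiv_lt_0_compat; lra).
    assert (i2 : 0 < 2 * c / al) by (apply Rdiv_lt_0_compat; lra).
    assert (i3 : 0 < 2 * (c + 4 * al / S) / eps) by (apply Rdiv_lt_0_compat; lra).
    assert (i4 : 0 < 4 * al / S / phi / eps) by (apply Rdiv_lt_0_compat; lra).
    exists (2 + 8 / S + 2 * c / al + 2 * (c + 4 * al / S) / eps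
            + 4 * al / S / phi / eps).
    split; [lra|]. repeat split.
    - apply (proj1 (Rle_div_l _ _ _ hS)). lra.
    - apply (proj1 (Rlt_div_l _ _ _ hal)). lra.
    - apply (proj1 (Rlt_div_l _ _ _ heps)). lra.
    - apply (proj1 (Rlt_div_l _ _ _ heps)). lra. }
  destruct hex as [N [n1 [n2 [n3 [n4 n5]]]]].
  set (E := exp (- N * phi)).
  assert (hE : 0 < E) by apply exp_pos.
  assert (hEN : E * (N * phi) <= 1).
  { assert (h := exp_ineq1_le (N * phi)).
    assert (e : E * exp (N * phi) = 1).
    { unfold E. rewrite <- exp_plus. replace (- N * phi + N * phi) with 0 by ring.
      apply exp_0. }
    assert (E * (1 + N * phi) <= 1) by (rewrite <- e; apply Rmult_le_compat_l; lra).
    lra. }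
  assert (hE1 : E <= 1).
  { unfold E. rewrite <- exp_0. apply Rlt_le, exp_increasing. nra. }
  set (M := N * N + 1). assert (hM : 0 < M) by (unfold M; nra).
  (* [K * B = al - c * T / M] is the condition [q phi = v] once the other
     coefficients are eliminated through the conditions at [0]. *)
  set (T := E - C + N * S).
  set (K := 2 * N * T / M + phi * E - S).
  (* [K] tends to [S] as [N] grows. This lower bound keeps [B] below [2 * al / S] independently of
     [N], which makes [A] of order [1 / N]. *)
  assert (hK : S / 2 <= K).
  { apply Rmult_le_reg_r with M; [exact hM|].
    replace (K * M) with (2 * N * T + (phi * E - S) * M) by (unfold K; field; lra).
    unfold T, M.
    assert (0 <= N * E) by nra.
    assert (0 <= phi * E * (N * N + 1)) by (apply Rmult_le_pos; nra).
    assert (N * C <= N) by nra.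
    assert (8 * N <= N * (N * S)) by nra.
    nra. }
  set (B := (al - c * T / M) / K).
  assert (hT : 0 <= T) by (unfold T; lra).
  assert (hrhs : 0 < al - c * T / M).
  { apply Rlt_0_minus. apply Rlt_div_l; [exact hM|].
    assert (T <= 2 * N) by (unfold T; nra).
    assert (c * T <= c * (2 * N)) by (apply Rmult_le_compat_l; lra).
    assert (2 * c * N <= N * al * N) by (apply Rmult_le_compat_r; lra).
    unfold M. lra. }
  assert (hrhs2 : al - c * T / M <= al).
  { assert (0 <= c * T / M); [|lra].
    apply Rdiv_le_0_compat; [apply Rmult_le_pos; lra | exact hM]. }
  assert (hB : 0 < B) by (apply Rdiv_lt_0_compat; lra).
  assert (hB2 : B <= 2 * al / S).
  { apply (proj1 (Rle_div_r _ _ _ hS)).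
    assert (e : B * K = al - c * T / M) by (unfold B; field; lra).
    assert (B * (S / 2) <= B * K) by (apply Rmult_le_compat_l; lra). lra. }
  (* Forced by the condition [q 0 + q'' 0 = c], which reads [A * M - 2 * N * B = c]. Likewise [D]
     below is forced by [q' 0 = s]. *)
  set (A := (c + 2 * N * B) / M).
  assert (hA : 0 < A).
  { apply Rdiv_lt_0_compat; [|exact hM].
    assert (0 < N * B) by (apply Rmult_lt_0_compat; lra). lra. }
  assert (hAM : A * M = c + 2 * N * B) by (unfold A; field; lra).
  assert (e : A * T + B * (phi * E - S) = al).
  { unfold A. replace al with ((al - c * T / M) + c * T / M) by ring.
    replace (al - c * T / M) with (B * K) by (unfold B; field; lra).
    unfold K. field. lra. }
  set (D := s - B + N * A).
  exists (fun t => (A + B * t) * exp (- N * t) + (b - A) * cos t + D * sin t),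
    (fun t => (B - N * A - N * B * t) * exp (- N * t) - (b - A) * sin t + D * cos t),
    (fun t => (N * N * A + N * N * B * t - 2 * N * B) * exp (- N * t)
              - (b - A) * cos t - D * sin t).
  split; [|repeat split].
  - split; [|split]; intros u.
    + auto_derive; [trivial | ring].
    + auto_derive; [trivial | ring].
    + apply derivable_continuous_pt. apply ex_derive_Reals_0. auto_derive. trivial.
  - rewrite !Rmult_0_r, exp_0, cos_0, sin_0. ring.
  - rewrite !Rmult_0_r, exp_0, cos_0, sin_0. unfold D. ring.
  - rewrite !Rmult_0_r, exp_0, cos_0, sin_0. unfold M in hAM. lra.
  - fold E S C.
    unfold T, al in e. unfold D. lra.
  - intros t ht.
    (* The sinusoidal terms drop out of [q + q''], leaving an exponential times an affine function
       with positive coefficients. *)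
    match goal with |- 0 < ?x => replace x with ((c + M * B * t) * exp (- N * t)) end.
    + apply Rmult_lt_0_compat; [|apply exp_pos].
      assert (0 <= M * B * t)
        by (apply Rmult_le_pos; [apply Rmult_le_pos|]; lra). lra.
    + replace c with (A * M - 2 * N * B) by lra. unfold M. ring.
  - fold E S C.
    (* The functional [q 0 - q phi * cos phi + q' phi * sin phi] vanishes on sinusoids, so only the
       exponential term contributes; its value is at most [A + B * E * S]. *)
    match goal with |- ?x < _ =>
      replace x with (A - (A + B * phi) * E * C + (B - N * A - N * B * phi) * E * S)
    end.
    + assert (0 < N * phi) by (apply Rmult_lt_0_compat; lra).
      assert (h1 : A * N <= c + 4 * al / S).
      { apply Rmult_le_reg_r with N; [lra|].
        assert (N * B <= N * (2 * al / S)) by (apply Rmult_le_compat_l; lra).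
        assert (c * 1 <= c * N) by (apply Rmult_le_compat_l; lra).
        unfold M in hAM. lra. }
      assert (h2 : 2 * (B * E) * N <= 4 * al / S / phi).
      { apply (proj1 (Rle_div_r _ _ _ (proj1 hphi))).
        assert (B * (E * (N * phi)) <= B * 1) by (apply Rmult_le_compat_l; lra). lra. }
      assert (h3 : A < eps / 2) by (apply Rmult_lt_reg_r with N; lra).
      assert (h4 : B * E < eps / 2) by (apply Rmult_lt_reg_r with N; lra).
      assert (hBp : 0 < B * phi) by (apply Rmult_lt_0_compat; lra).
      assert (0 <= (A + B * phi) * E * C) by (repeat apply Rmult_le_pos; lra).
      assert (0 <= N * (A + B * phi) * E * S) by (repeat apply Rmult_le_pos; lra).
      assert (B * E * S <= B * E * 1)
        by (apply Rmult_le_compat_l; [apply Rmult_le_pos|]; lra).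
      lra.
    + replace v with (al + b * C + s * S) by (unfold al; ring).
      rewrite <- e. unfold T, D.
      replace (b - (A * (E - C + N * S) + B * (phi * E - S) + b * C + s * S) * C
        + ((B - N * A - N * B * phi) * E - (b - A) * S + (s - B + N * A) * C) * S)
        with (b - b * (S * S + C * C) + A * (S * S + C * C)
          - (A + B * phi) * E * C + (B - N * A - N * B * phi) * E * S) by ring.
      rewrite hSC. ring.
Qed.

(** * Chaining arcs through prescribed nodes *)

Lemma C2_shift (L : R) (q q' q'' : R -> R) :
  C2_with q q' q'' ->
  C2_with (fun u => q (u - L)) (fun u => q' (u - L)) (fun u => q'' (u - L)).
Proof.
  intros [Q1 [Q2 Q3]].
  assert (H : forall f f' : R -> R, (forall u, is_derive f u (f' u)) ->
            forall u, is_derive (fun u => f (u - L)) u (f' (u - L))).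
  { intros f f' Hf u. rewrite <- (Rmult_1_l (f' (u - L))).
    apply (is_derive_comp f (fun u => u - L)); [apply Hf|].
    auto_derive; [trivial | ring]. }
  split; [|split].
  - now apply H.
  - now apply H.
  - intros u. apply (continuity_pt_comp (fun u => u - L) q''); [|apply Q3].
    apply derivable_continuous_pt. apply ex_derive_Reals_0. auto_derive. trivial.
Qed.

(** Induction on the number of arcs. The slope bound is the invariant: it places the tangent
    sinusoid at node [m] below [b (S m)] at the next node, as [arc_exists] demands. The clause for
    [m = 0] serves the positivity of the first arc. *)
Lemma interpolate (phi : R) (b : nat -> R) (m : nat) :
  0 < phi < PI / 2 -> b 0%nat = 0 -> 0 < b 1%nat ->
  (forall j, (0 < j < m)%nat -> 0 < b j) ->
  0 <= b m ->
  (forall j, (0 < j <= m)%nat -> 0 < b (pred j) + b (S j) - 2 * b j * cos phi) ->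
  exists p p' p'' : R -> R, C2_with p p' p'' /\
    (forall u, 0 <= u <= INR m * phi -> 0 < p u + p'' u) /\
    (forall j, (j <= m)%nat -> p (INR j * phi) = b j) /\
    (forall u, 0 < u < INR m * phi -> 0 < p u) /\
    p' (INR m * phi) * sin phi < b (S m) - b m * cos phi /\
    (m = 0%nat -> 0 < p' 0).
Proof.
  intros hphi b0 b1.
  assert (hS : 0 < sin phi) by (apply sin_gt_0; lra).
  induction m as [|m IH]; intros hb hbm hd.
  (* The interval is the single point 0, so only the initial data matter: value 0, a slope with
     [s * sin phi] below [b 1], and [p + p'' = 1]. *)
  - set (s := b 1%nat / 2 / sin phi).
    assert (hs : 0 < s) by (repeat apply Rdiv_lt_0_compat; lra).
    exists (fun u => 1 - cos u + s * sin u), (fun u => sin u + s * cos u),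
      (fun u => cos u - s * sin u).
    simpl. split; [split; [|split]; intros u|].
    + auto_derive; [trivial | ring].
    + auto_derive; [trivial | ring].
    + apply derivable_continuous_pt. apply ex_derive_Reals_0. auto_derive. trivial.
    + rewrite Rmult_0_l, sin_0, cos_0. repeat split.
      * intros u _. lra.
      * intros j hj. replace j with 0%nat by lia. simpl.
        rewrite Rmult_0_l, sin_0, cos_0, b0. ring.
      * intros u hu. lra.
      * rewrite b0. replace ((0 + s * 1) * sin phi) with (b 1%nat / 2)
          by (unfold s; field; lra). lra.
      * intros _. lra.
  - destruct IH as [p [p' [p'' [PC [Pf [Pb [Ppos [Ps P0]]]]]]]].
    { intros j hj. apply hb. lia. }
    { destruct m; [lra|]. apply Rlt_le, hb. lia. }
    { intros j hj. apply hd. lia. }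
    set (L := INR m * phi) in *.
    assert (hL : 0 <= L) by (apply Rmult_le_pos; [apply pos_INR | lra]).
    assert (eL : INR (S m) * phi = L + phi) by (rewrite S_INR; unfold L; ring).
    assert (hdm := hd (S m) ltac:(lia)). simpl pred in hdm.
    assert (hc : 0 < p L + p'' L) by (apply Pf; lra).
    assert (hm : (0 < m)%nat -> 0 < b m) by (intros h; apply hb; lia).
    (* The first bound on [eps] carries the slope invariant to the next node; the second, for later
       arcs, makes [b (S m) * cos phi - q' phi * sin phi] positive. *)
    assert (heps : exists eps, 0 < eps /\
      eps <= b m + b (S (S m)) - 2 * b (S m) * cos phi /\
      ((0 < m)%nat -> eps <= b m)).
    { destruct (Nat.eq_dec m 0) as [e|ne].
      - exists (b m + b (S (S m)) - 2 * b (S m) * cos phi).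
        repeat split; [exact hdm | lra | intros; lia].
      - assert (h := hm ltac:(lia)).
        exists (Rmin (b m) (b m + b (S (S m)) - 2 * b (S m) * cos phi)).
        repeat split; [now apply Rmin_glb_lt | apply Rmin_r | intros; apply Rmin_l]. }
    destruct heps as [eps [he [hed hem]]].
    assert (PL : p L = b m) by (apply Pb; lia).
    destruct (arc_exists phi (p L) (p' L) (p L + p'' L) (b (S m)) eps hphi hc he)
      as [q [q' [q'' [QC [Q0 [Q0' [Q0'' [Qv [Qf Qs]]]]]]]]].
    { rewrite PL. lra. }
    assert (e0 : p L = q (L - L)) by now rewrite Rminus_diag_eq.
    assert (e1 : p' L = q' (L - L)) by now rewrite Rminus_diag_eq.
    assert (e2 : p'' L = q'' (L - L)) by (rewrite Rminus_diag_eq by easy; lra).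
    assert (Qpos : forall t, 0 < t < phi -> 0 < q t).
    { intros t ht. destruct QC as [QC1 [QC2 _]].
      assert (I1 : forall u, Icc 0 phi u -> D_in q q' (Icc 0 phi) u)
        by (intros; now apply is_derive_D_in).
      assert (I2 : forall u, Icc 0 phi u -> D_in q' q'' (Icc 0 phi) u)
        by (intros; now apply is_derive_D_in).
      assert (I3 : forall u, Icc 0 phi u -> q u + q'' u > 0)
        by (intros u [hu _]; now apply Qf).
      (* The first arc starts at value 0 with positive slope, so its tangent sinusoid at 0 is
         already positive. *)
      destruct (Nat.eq_dec m 0) as [e|ne].
      - assert (h := tangent_right 0 phi q q' q'' I1 I2 I3 0 t
                       ltac:(lra) ltac:(lra) ltac:(lra) ltac:(lra)).
        assert (eL0 : L = 0) by (unfold L; rewrite e; simpl; ring).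
        assert (h0 := P0 e). rewrite Q0, Q0', PL, e, b0, eL0, Rminus_0_r in h.
        assert (0 < sin t) by (apply sin_gt_0; lra).
        assert (0 < p' 0 * sin t) by (now apply Rmult_lt_0_compat). lra.
      (* Multiplied by [sin phi], the tangent sinusoid at the right end becomes [sin (phi - t) * (b
         (S m) * cos phi - q' phi * sin phi) + b (S m) * sin t]. The last term may vanish, as
         [b (S m)] does at the final node. *)
      - assert (h := tangent_left 0 phi q q' q'' I1 I2 I3 t phi
                       ltac:(lra) ltac:(lra) ltac:(lra) ltac:(lra)).
        rewrite Qv in h.
        assert (hst : 0 < sin (phi - t)) by (apply sin_gt_0; lra).
        assert (ht' : 0 < sin t) by (apply sin_gt_0; lra).
        replace t with (phi - (phi - t)) in ht' by ring. rewrite sin_minus in ht'.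
        assert (hg : 0 < b (S m) * cos phi - q' phi * sin phi).
        { assert (h' := hem ltac:(lia)). lra. }
        assert (g1 := Rmult_lt_0_compat _ _ hst hg).
        assert (g2 := Rmult_le_pos _ _ hbm (Rlt_le _ _ ht')).
        eapply Rlt_trans; [|exact h].
        apply Rmult_lt_reg_r with (sin phi); [exact hS|]. lra. }
    exists (glue L p (fun u => q (u - L))), (glue L p' (fun u => q' (u - L))),
      (glue L p'' (fun u => q'' (u - L))).
    rewrite eL. split; [|repeat split].
    + apply C2_glue; auto. now apply C2_shift.
    + intros u hu. destruct (Rle_dec u L).
      * rewrite !glue_le by lra. apply Pf. lra.
      * rewrite !glue_ge by (auto; lra). apply Qf. lra.
    + intros j hj. destruct (Nat.eq_dec j (S m)) as [->|ne].
      * rewrite eL, glue_ge by (auto; lra). now replace (L + phi - L) with phi by ring.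
      * rewrite glue_le; [apply Pb; lia|].
        apply Rmult_le_compat_r; [lra | apply le_INR; lia].
    + intros u hu. destruct (Rtotal_order u L) as [h|[h|h]].
      * rewrite glue_le by lra. apply Ppos. lra.
      * rewrite glue_le, h, PL by lra. apply hm.
        destruct m; [|lia]. unfold L in h. simpl in h. lra.
      * rewrite glue_ge by (auto; lra). apply Qpos. lra.
    + rewrite glue_ge by (auto; lra). replace (L + phi - L) with phi by ring.
      rewrite PL in Qs. lra.
    + easy.
Qed.

(** * Part (ii) and the assembled theorem *)

Lemma solution_sampled (phi : R) (n : Z) (a : Z -> R) :
  0 < phi < PI / 2 -> (0 <= n)%Z -> solves_system phi n a ->
  exists p : R -> R,
    admissible ((IZR n + 2) * phi) p /\ sampled_from phi n p a.
Proof.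
  intros hphi hn [Ha [a0 a1]].
  set (N := Z.to_nat n). assert (eN : Z.of_nat N = n) by (apply Z2Nat.id; lia).
  assert (eI : INR (N + 2) = IZR n + 2).
  { rewrite INR_IZR_INZ, Nat2Z.inj_add, eN, plus_IZR. reflexivity. }
  (* Node [j] carries [a (j - 1)]. The default 0 supplies the value one step past the last node
     [N + 2], which [interpolate] also reads. *)
  set (b := fun j => if (j <=? N + 2)%nat then a (Z.of_nat j - 1)%Z else 0).
  assert (bE : forall j, (j <= N + 2)%nat -> b j = a (Z.of_nat j - 1)%Z).
  { intros j hj. unfold b. now rewrite (proj2 (Nat.leb_le _ _) hj). }
  assert (bN : b (N + 2)%nat = 0).
  { rewrite bE by lia. replace (Z.of_nat (N + 2) - 1)%Z with (n + 1)%Z by lia.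
    exact a1. }
  assert (bpos : forall j, (0 < j < N + 2)%nat -> 0 < b j).
  { intros j hj. rewrite bE by lia. apply Ha. lia. }
  destruct (interpolate phi b (N + 2) hphi) as
    [p [p' [p'' [[C1 [C2 C3]] [Pf [Pb [Ppos _]]]]]]].
  - rewrite bE by lia. exact a0.
  - apply bpos. lia.
  - exact bpos.
  - lra.
  (* At the last node both [b (N + 2)] and its successor are 0, so the inequality reduces to
     [0 < b (N + 1)]. *)
  - intros j hj. destruct (Nat.eq_dec j (N + 2)) as [->|ne].
    + rewrite bN. assert (h := bpos (pred (N + 2)) ltac:(lia)).
      replace (b (S (N + 2))) with 0; [lra|].
      unfold b. now rewrite (proj2 (Nat.leb_gt _ _)) by lia.
    + rewrite !bE by lia.
      replace (Z.of_nat (pred j) - 1)%Z with (Z.of_nat j - 1 - 1)%Z by lia.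
      replace (Z.of_nat (S j) - 1)%Z with (Z.of_nat j - 1 + 1)%Z by lia.
      apply Ha. lia.
  - rewrite eI in Pf, Ppos. exists p. split; [split; [|split; [|split]]|split].
    + exists p', p''. repeat split; intros u hu.
      * now apply is_derive_D_in.
      * now apply is_derive_D_in.
      * apply continuity_pt_continue_in, C3.
      * apply Pf, hu.
    + assert (h := Pb 0%nat ltac:(lia)). simpl in h. rewrite Rmult_0_l in h.
      rewrite h, bE by lia. exact a0.
    + rewrite <- eI, Pb by lia. exact bN.
    + exact Ppos.
    + intros k hk. assert (h := Pb (Z.to_nat (k + 1)) ltac:(lia)).
      rewrite INR_IZR_INZ, bE, Z2Nat.id, plus_IZR in h by lia.
      rewrite h. f_equal. lia.
    + exact a1.
Qed.

Theorem mainTheorem4 (phi : R) (hphi : 0 < phi < PI / 2) :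
  (forall (u1 : R) (p : R -> R) (n : Z) (a : Z -> R),
     0 < u1 ->
     admissible u1 p ->
     (IZR n + 1) * phi < u1 <= (IZR n + 2) * phi ->
     sampled_from phi n p a ->
     solves_system phi n a) /\
  (forall (n : Z) (a : Z -> R),
     (0 <= n)%Z ->
     solves_system phi n a ->
     exists (u1 : R) (p : R -> R),
       0 < u1 /\
       admissible u1 p /\
       (IZR n + 1) * phi < u1 <= (IZR n + 2) * phi /\
       sampled_from phi n p a).
Proof.
  split.
  - intros u1 p n a h1 h2 h3 h4. now apply (sampled_solves phi u1 p).
  - intros n a hn ha.
    destruct (solution_sampled phi n a hphi hn ha) as [p [hp hs]].
    apply IZR_le in hn.
    exists ((IZR n + 2) * phi), p. split; [|split; [exact hp|split; [|exact hs]]].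
    + apply Rmult_lt_0_compat; lra.
    + lra.
Qed.
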